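(* Let $\Omega$ be a topological signature and let $A$ be a Stone topological $\Omega$-algebra. The following conditions are equivalent: (1) $A$ is profinite; (2) for every clopen subset $L\subseteq A$, $\sigma_L$ is a clopen congruence; (3) $M(A)$ is equicontinuous; (4) $M(A)$ is relatively compact in $\mathcal{C}(A)$; (5) the closure of $M(A)$ in $\mathcal{C}(A)$ is a profinite submonoid; (6) for every clopen subset $L\subseteq A$, there exists a continuous homomorphism $\varphi:A\to B$ onto a finite algebra $B$ such that $L=\varphi^{-1}(\varphi(L))$; (7) for every clopen subset $L\subseteq A$, the congruence $\sigma_L$ is determined by some finite set of terms; (8) for every clopen subset $L\subseteq A$, the congruence $\sigma_L$ is $F$-determined by some finite subset $F$ of $M(A)$; (9) for every clopen subset $L\subseteq A$, the congruence $\sigma_L$ is $F$-determined by some finite subset $F$ of $\mathcal{C}(A)$; (10) for every clopen subset $L\subseteq A$, the congruence $\sigma_L$ is $C$-determined by some compact subset $C$ of $\mathcal{C}(A)$.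
   Context: A topological signature is a sequence $\Omega=(\Omega_n)_{n\in\mathbb{N}}$ (with $0\in\mathbb{N}$) of topological spaces. An $\Omega$-algebra is a set $A$ with evaluation maps $E_n^A:\Omega_n\times A^n\to A$ ($n\in\mathbb{N}$); for $w\in\Omega_n$ write $w_A(a_1,\ldots,a_n)=E_n^A(w,a_1,\ldots,a_n)$. It is a topological $\Omega$-algebra if $A$ is a topological space and every $E_n^A$ is continuous. Compact spaces are required to be Hausdorff. A Stone space is a compact 0-dimensional space; a Stone topological algebra is a topological algebra whose underlying space is a Stone space. Finite algebras are viewed as discrete topological algebras (the evaluation maps being required to be continuous). A topological algebra $A$ is residually finite if for all distinct $a,a'\in A$ there is a continuous homomorphism $\varphi:A\to B$ into a finite (discrete) topological algebra with $\varphi(a)\neq\varphi(a')$; $A$ is profinite if it is compact and residually finite. (The same definition, applied to monoids, defines profinite monoids.) Let $T_\Omega(X)$ be the algebra of $\Omega$-terms over the set of variables $X$. A term is linear in a variable $x$ if $x$ occurs in it exactly once. The translation monoid $M(A)$ is the set of all maps $A\to A$ of the form $a\mapsto t_A(a_1,\ldots,a_{i-1},a,a_{i+1},\ldots,a_m)$, where $t\in T_\Omega(\{x_1,\ldots,x_m\})$ is linear in $x_i$ and $a_j\in A$ ($j\ne i$). The syntactic congruence $\sigma_L$ of $L\subseteq A$ is $\{(a,a')\in A\times A:\forall f\in M(A)\ (f(a)\in L\iff f(a')\in L)\}$; it is the largest congruence on $A$ for which $L$ is a union of classes. A congruence is clopen if it is a clopen subset of $A\times A$. $\mathcal{C}(A)$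 is the monoid (under composition) of continuous maps $A\to A$ with the compact-open topology; $M(A)$ is a submonoid of it. A subset of a topological space is relatively compact if it is contained in a compact subset. A compact space $X$ has a unique uniform structure inducing its topology, whose entourages are the subsets of $X\times X$ containing an open neighborhood of the diagonal; a set $\mathcal{F}$ of continuous maps $X\to X$ is equicontinuous if for every entourage $\alpha$ of $X$ and every $x\in X$ there is an open $U\subseteq X$ with $x\in U$ and $f(U)\times f(U)\subseteq\alpha$ for every $f\in\mathcal{F}$. For a set $S$ of functions $A\to A$, $\sigma_L$ is $S$-determined if for all $a,a'\in A$: $(a,a')\in\sigma_L$ if and only if $\forall f\in S\ (f(a)\in L\iff f(a')\in L)$. $\sigma_L$ is determined by a finite set of terms if there are $m\geq 1$ and a finite subset $F$ of $T_\Omega(\{x_1,\ldots,x_m\})$ such that $\sigma_L$ consists of all pairs $(a,a')\in A^2$ for which $\forall t\in F\ \forall b_2,\ldots,b_m\in A\ (t_A(a,b_2,\ldots,b_m)\in L\iff t_A(a',b_2,\ldots,b_m)\in L)$. *)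

(* Defs.v *)
From HB Require Import structures.
From mathcomp Require Import all_boot all_classical.
From mathcomp Require Import topology.

Set Implicit Arguments.
Unset Strict Implicit.
Unset Printing Implicit Defensive.

(* [continuousType A A] carries the compact-open topology from here on. *)
Import ArrowAsCompactOpen.

Local Open Scope classical_set_scope.

Definition compact_hausdorff (A : topologicalType) : Prop :=
  compact [set: A] /\ hausdorff_space A.

(* Zero-dimensionality is the existence of a basis of clopen sets; the
   library's [zero_dimensional] only asks that clopen sets separate points,
   which is the same thing in the compact Hausdorff case. *)
Definition stone_space (A : topologicalType) : Prop :=
  compact_hausdorff A /\ basis (@clopen A).

(* The compact subsets considered below lie in the space of continuous maps
   from a Hausdorff space to itself, which is Hausdorff; hence no separation
   axiom is required of the compact set itself. *)
Definition relatively_compact (T : topologicalType) (S : set T) : Prop :=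
  exists2 K : set T, compact K & S `<=` K.

(* The entourages of the unique uniformity of a compact Hausdorff space. The
   library's [equicontinuous] needs a uniform structure given in advance (and a
   nonempty codomain). *)
Definition compact_entourage (A : topologicalType) (alpha : set (A * A)) :
    Prop :=
  exists2 V : set (A * A), open V & diagonal `<=` V /\ V `<=` alpha.

Definition equicontinuous_on (A : topologicalType) (F : set (A -> A)) : Prop :=
  forall alpha : set (A * A), compact_entourage alpha -> forall x : A,
  exists U : set A, [/\ open U, U x &
    forall f, F f -> (f @` U) `*` (f @` U) `<=` alpha].

Section Algebras.
Variable Omega : nat -> topologicalType.

Record topAlgebra (A : topologicalType) := TopAlgebra {
  eval_op : forall n, Omega n -> ('I_n -> A) -> A;
  eval_op_continuous : forall n,
    continuous (fun p : Omega n * {ptws 'I_n -> A} => eval_op p.1 p.2) }.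

Definition alg_hom (A B : topologicalType) (EA : topAlgebra A)
    (EB : topAlgebra B) (phi : A -> B) : Prop :=
  forall n (w : Omega n) (a : 'I_n -> A),
    phi (eval_op EA w a) = eval_op EB w (phi \o a).

Definition residually_finite_alg (A : topologicalType) (EA : topAlgebra A) :
    Prop :=
  forall a a' : A, a <> a' ->
  exists (B : discreteTopologicalType) (EB : topAlgebra B) (phi : A -> B),
    [/\ finite_set [set: B], continuous phi, alg_hom EA EB phi &
        phi a <> phi a'].

Definition profinite_alg (A : topologicalType) (EA : topAlgebra A) : Prop :=
  compact_hausdorff A /\ residually_finite_alg EA.

Inductive term (X : Type) : Type :=
  | Var of X
  | App n of Omega n & ('I_n -> term X).

Fixpoint eval_term (A : topologicalType) (EA : topAlgebra A) (X : Type)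
    (v : X -> A) (t : term X) : A :=
  match t with
  | Var x => v x
  | App n w ts => eval_op EA w (fun i => eval_term EA v (ts i))
  end.

Fixpoint occurrences (X : eqType) (x : X) (t : term X) : nat :=
  match t with
  | Var y => (y == x)
  | App n w ts => \sum_(i < n) occurrences x (ts i)
  end.

Definition linear_in (X : eqType) (x : X) (t : term X) : Prop :=
  occurrences x t = 1.

(* [a] is only given away from [i], so that the identity belongs to the
   translation monoid even when [A] is empty. *)
Definition subst_at (A : Type) (m : nat) (i : 'I_m)
    (a : {j : 'I_m | j != i} -> A) (x : A) (j : 'I_m) : A :=
  oapp a x (insub j).

Definition subst_first (A : Type) (m : nat) (a : A) (b : 'I_m -> A)
    (j : 'I_m.+1) : A :=
  oapp b a (unlift ord0 j).

Section Conditions.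
Variables (A : topologicalType) (EA : topAlgebra A).

Definition translations : set (A -> A) :=
  [set f | exists (m : nat) (t : term 'I_m) (i : 'I_m)
             (a : {j : 'I_m | j != i} -> A),
           linear_in i t /\ f = fun x => eval_term EA (subst_at a x) t].

(* Translations are continuous, so no map is lost here. *)
Definition ctranslations : set (continuousType A A) :=
  [set f | translations f].

Definition congruence (R : set (A * A)) : Prop :=
  [/\ forall a, R (a, a),
      forall a b, R (a, b) -> R (b, a),
      forall a b c, R (a, b) -> R (b, c) -> R (a, c) &
      forall n (w : Omega n) (a b : 'I_n -> A),
        (forall i, R (a i, b i)) -> R (eval_op EA w a, eval_op EA w b)].

Definition syntactic (L : set A) : set (A * A) :=
  [set p | forall f, translations f -> (L (f p.1) <-> L (f p.2))].

Definition determined_by (L : set A) (S : set (A -> A)) : Prop :=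
  forall a a' : A,
    syntactic L (a, a') <-> (forall f, S f -> (L (f a) <-> L (f a'))).

Definition determined_by_finite_terms (L : set A) : Prop :=
  exists (m : nat) (F : set (term 'I_m.+1)), finite_set F /\
    forall a a' : A, syntactic L (a, a') <->
      (forall t, F t -> forall b : 'I_m -> A,
         L (eval_term EA (subst_first a b) t) <->
         L (eval_term EA (subst_first a' b) t)).

End Conditions.
End Algebras.

Record topMonoid (N : topologicalType) := TopMonoid {
  mon_one : N;
  mon_mul : N -> N -> N;
  mon_mulA : associative mon_mul;
  mon_mul1m : left_id mon_one mon_mul;
  mon_mulm1 : right_id mon_one mon_mul;
  mon_mul_continuous : continuous (fun p : N * N => mon_mul p.1 p.2) }.

Definition mon_hom (N B : topologicalType) (MN : topMonoid N)
    (MB : topMonoid B) (phi : N -> B) : Prop :=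
  phi (mon_one MN) = mon_one MB /\
  forall x y, phi (mon_mul MN x y) = mon_mul MB (phi x) (phi y).

Definition residually_finite_mon (N : topologicalType) (MN : topMonoid N) :
    Prop :=
  forall x y : N, x <> y ->
  exists (B : discreteTopologicalType) (MB : topMonoid B) (phi : N -> B),
    [/\ finite_set [set: B], continuous phi, mon_hom MN MB phi &
        phi x <> phi y].

Definition profinite_mon (N : topologicalType) (MN : topMonoid N) : Prop :=
  compact_hausdorff N /\ residually_finite_mon MN.

(* [S], with the subspace topology, carries a (necessarily unique) structure of
   topological monoid for which the inclusion into the monoid of continuous maps
   under composition is a homomorphism, and this monoid is profinite. *)
Definition profinite_submonoid (A : topologicalType)
    (S : set (continuousType A A)) : Prop :=
  exists MS : topMonoid (set_type S),
    [/\ set_val (mon_one MS) = idfun :> (A -> A),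
        forall f g : set_type S,
          set_val (mon_mul MS f g) =
            (set_val f : A -> A) \o (set_val g : A -> A) :> (A -> A) &
        profinite_mon MS].

(* Main.v *)
Require Import Defs.
From HB Require Import structures.
From mathcomp Require Import all_boot all_classical.
From mathcomp Require Import topology.
From mathcomp Require Import zify.

Set Implicit Arguments.
Unset Strict Implicit.
Unset Printing Implicit Defensive.

Import ArrowAsCompactOpen.
Local Open Scope classical_set_scope.

(** Everything is compared with the single condition [clopen_syntactic]: every
    clopen [L] has a clopen syntactic congruence [sigma_L]. Since [sigma_L] is
    an equivalence relation, this only says that each [x] has a neighborhood
    contained in its own class ([equivalence_clopen]).

    Conditions that yield [clopen_syntactic]. If [A] is residually finite, a
    compactness argument ([compact_finite_bigcap]) gives finitely many kernels
    of homomorphisms to finite algebras whose intersection does not separate a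
    point of [L] from a point outside [L]. This intersection is a congruence
    with open classes and is contained in [sigma_L], because congruences are
    preserved by translations. If the translations are equicontinuous, the
    entourage of the pairs on which [L] agrees produces the required
    neighborhoods. If [sigma_L] is determined by a compact family of maps, or by
    finitely many terms whose remaining variables range over the compact space
    [A^m], a tube lemma ([near_compact_agree]) produces them.

    Consequences of [clopen_syntactic]. The quotients [A / sigma_L] are finite
    discrete algebras and recognize [L], so [A] is profinite since clopen sets
    separate points. By compactness, finitely many of the closed conditions
    [L (f a) <-> L (f b)], with [f] a translation, already define the open set
    [sigma_L], which gives the finite determinations; and every entourage of [A]
    contains the agreement relation of finitely many clopen sets, which gives
    equicontinuity. For relative compactness, the continuous maps [f] such that
    [sigma_L] refines the agreement on the preimage of [L] by [f], for all
    clopen [L], form a compact set containing the translations: the pointwise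
    limit of an ultrafilter of such maps satisfies the same condition, is
    continuous because [sigma_L] is open, and is a limit for the compact-open
    topology for the same reason ([syntactic_compatible_compact]); this is the
    relevant part of Ascoli's theorem. Finally, the closure of the translations
    preserves every [sigma_L], so it acts on the finite sets [A / sigma_L], and
    these actions separate its elements, which makes it a profinite monoid.

    Conversely, relative compactness makes each [sigma_L] determined by a
    compact family, the closure of the translations, because the agreement
    conditions pass from translations to their limits. *)

(** * Compactness and equivalence relations with open classes *)

Section CompactSpaces.
Context {X : topologicalType}.

(** The finite subsets of [D], ordered by inclusion, are used as a directed
    family in the near-covering form of compactness: each point is either in
    [V] or excluded by one of the closed sets. *)
Lemma compact_finite_bigcap {I : Type} (D : set I) (R : I -> set X)
    (V : set X) :
  compact [set: X] -> (forall i, D i -> closed (R i)) -> open V ->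
  \bigcap_(i in D) R i `<=` V ->
  exists E : set I, [/\ finite_set E, E `<=` D & \bigcap_(i in E) R i `<=` V].
Proof.
move=> /compact_near_coveringP cX clR oV DV.
pose F := filter_from [set E : set I | finite_set E /\ E `<=` D]
            (fun E => [set E' | E `<=` E']).
have FF : Filter F.
  apply: filter_from_filter; first by exists set0; split.
  move=> E1 E2 [fE1 E1D] [fE2 E2D]; exists (E1 `|` E2).
    by rewrite /= finite_setU subUset.
  by move=> E' /=; rewrite subUset.
have near_E : forall x, [set: X] x -> \forall x' \near x & E \near F,
    (\bigcap_(i in E) R i) x' -> V x'.
  move=> x _; have [Vx|nVx] := pselect (V x).
    exists (V, setT); last by case=> x' E [].
    split; [exact: open_nbhs_nbhs | exact: (@filterT _ F)].
  have [i Di nRx] : exists2 i, D i & ~ R i x.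
    apply: contrapT => nR; apply/nVx/DV => i Di.
    by apply: contrapT => nRi; apply: nR; exists i.
  exists (~` R i, [set E | E i]); last by case=> x' E /= [nR Ei] /(_ i Ei).
  split=> /=.
    by apply: open_nbhs_nbhs; split=> //; exact/closed_openC/clR.
  exists [set i]; last by move=> E; apply.
  by split=> // _ ->.
have [E [fE ED] EP] :=
  cX _ F (fun E x => (\bigcap_(i in E) R i) x -> V x) FF near_E.
by exists E; split=> // x; apply: EP.
Qed.

Lemma near_finite_forall {I T : Type} (E : set I) (F : set_system T)
    (P : I -> T -> Prop) : Filter F -> finite_set E ->
  (forall i, E i -> \forall x \near F, P i x) ->
  \forall x \near F, forall i, E i -> P i x.
Proof.
move=> FF /(@finite_fsetP {classic I})[D ->] EP.
apply: filterS (filter_bigI (D := D) (f := P) _ _) => [x|i Di].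
  by move=> + i Di; apply.
exact: EP.
Qed.

Lemma clopen_near (L : set X) (x : X) : clopen L ->
  \forall y \near x, L y <-> L x.
Proof.
move=> Lc; have [Lx|nLx] := pselect (L x).
  have : nbhs x L by case: Lc => oL _; exact: open_nbhs_nbhs.
  exact: filterS.
have : nbhs x (~` L).
  by case: (clopenC L Lc) => oL _; exact: open_nbhs_nbhs.
exact: filterS.
Qed.

Definition equivalence (R : set (X * X)) : Prop :=
  [/\ forall a, R (a, a), forall a b, R (a, b) -> R (b, a) &
      forall a b c, R (a, b) -> R (b, c) -> R (a, c)].

(** A product of two classes is an open rectangle on which [R] is constant. *)
Lemma equivalence_clopen (R : set (X * X)) : equivalence R ->
  (forall x, \forall y \near x, R (x, y)) -> clopen R.
Proof.
move=> [Rr Rs Rt] Rn.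
have Rcong a b : \forall p \near (a, b), R p <-> R (a, b).
  exists ([set a' | R (a, a')], [set b' | R (b, b')]).
    by split; exact: Rn.
  case=> a' b' /= [Ra Rb]; split=> Rab.
    by apply: (Rt _ a') => //; apply: (Rt _ b') => //; apply: Rs.
  by apply: (Rt _ a); [exact: Rs | exact: (Rt _ b)].
split.
  by rewrite openE => -[a b] Rab; apply: filterS (Rcong a b) => p [_]; apply.
rewrite -openC openE => -[a b] Rab.
by apply: filterS (Rcong a b) => p [Rp _] /Rp.
Qed.

(** The section [r] lets operations be transported to the quotient without
    choosing representatives again each time. *)
Lemma finite_discrete_quotient (R : set (X * X)) :
  compact [set: X] -> equivalence R ->
  (forall x, \forall y \near x, R (x, y)) ->
  exists (B : discreteTopologicalType) (pi : X -> B) (r : B -> X),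
    [/\ finite_set [set: B], continuous pi, cancel r pi &
        forall x y, R (x, y) <-> pi x = pi y].
Proof.
move=> cX [Rr Rs Rt] Rn.
pose cl x : set X := [set y | R (x, y)].
pose B : discreteTopologicalType := discrete_topology (set_type (range cl)).
have clP x : cl x \in range cl by apply/mem_set; exists x.
pose pi x : B := exist _ (cl x) (clP x).
have piP x y : R (x, y) <-> pi x = pi y.
  split=> [Rxy|[clxy]]; last by suff: cl x y by []; rewrite clxy.
  apply/val_inj => /=; apply/seteqP; split=> z /= ?; last exact: (Rt _ y).
  by apply: (Rt _ x) => //; exact: Rs.
have /choice[r rK] (b : B) : exists x, pi x = b.
  by case: b => c cR; have [x _ cx] := set_mem cR; exists x; exact: val_inj.
exists B, pi, r; split=> //.
- (* The complements of the classes are closed with empty intersection, so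
     finitely many classes cover the space. *)
  have [||E [fE _ EV]] := @compact_finite_bigcap X [set: X]
      (fun x => ~` cl x) set0 cX _ open0.
  + move=> x _; rewrite closedC openE => y Rxy.
    by apply: filterS (Rn y) => z; apply: Rt.
  + by move=> x /(_ x I); apply; exact: Rr.
  apply: sub_finite_set (finite_image pi fE) => b _.
  apply: contrapT => nb; apply: (EV (r b)) => x Ex Rxr; apply: nb.
  by exists x => //; rewrite -(rK b); apply/piP.
- move=> x; apply/discrete_cvg.
  by apply: filterS (Rn x) => y /piP.
Qed.

End CompactSpaces.

(** A tube lemma: near each [(s, x)] the truth value of [L (h s x)] is
    constant, and compactness of [K] makes the neighborhood of [x] uniform. *)
Lemma near_compact_agree {S X Y : topologicalType} (K : set S)
    (h : S -> X -> Y) (L : set Y) (x : X) :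
  compact K -> clopen L ->
  (forall s, K s -> h p.1 p.2 @[p --> (s, x)] --> h s x) ->
  \forall y \near x, forall s, K s -> (L (h s x) <-> L (h s y)).
Proof.
move=> /compact_near_coveringP cK Lc hc.
apply: (cK X (nbhs x) (fun y s => L (h s x) <-> L (h s y))) => s Ks.
have [[P Q] [/= sP xQ] PQ] := hc s Ks _ (clopen_near (h s x) Lc).
exists (P, Q) => // -[s' y] [/= Ps' Qy].
have := PQ (s', y) (conj Ps' Qy).
have := PQ (s', x) (conj Ps' (nbhs_singleton xQ)).
by move=> /= -> ->.
Qed.

Lemma ultra_fmap_cluster {T Y : topologicalType} (f : T -> Y)
    (F : set_system T) (y : Y) :
  UltraFilter F -> cluster (f @ F) y -> f @ F --> y.
Proof.
move=> FU clF V Vy; have [//|nV] := in_ultra_setVsetC (f @^-1` V) FU.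
by have [z []] := clF (~` V) V nV Vy.
Qed.

Lemma cvg_compact_ultra {T Y : topologicalType} (f : T -> Y)
    (F : set_system T) :
  compact [set: Y] -> UltraFilter F -> exists y : Y, f @ F --> y.
Proof.
move=> cY FU; have [|y [_ clF]] := cY (f @ F) _.
  exact: filterT.
by exists y; exact: ultra_fmap_cluster.
Qed.

(** * Maps into and out of products, discrete spaces and subspaces *)

Lemma ptws_continuous {I : Type} {T U : topologicalType}
    (g : T -> {ptws I -> U}) : (forall i, continuous (g ^~ i)) -> continuous g.
Proof.
move=> gc t; apply/cvg_sup => i V [_ /= [[B oB <-] Bgt] BV].
have nB : nbhs (g t i) B by exact: open_nbhs_nbhs.
by apply: (@filterS _ (nbhs t) _ _ _ _ (gc i t B nB)) => s; exact: BV.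
Qed.

Lemma discrete_continuous {B : discreteTopologicalType} {T : topologicalType}
    (f : B -> T) : continuous f.
Proof.
move=> b V Vb; apply: (@filterS _ (nbhs b) _ [set b] _ _ (discrete_set1 b)).
by move=> _ ->; exact: (nbhs_singleton Vb).
Qed.

Lemma discrete_pair_continuous {B : discreteTopologicalType}
    {T : topologicalType} (f : B * B -> T) : continuous f.
Proof.
move=> [b c] V Vbc; exists ([set b], [set c]).
  by split; exact: discrete_set1.
by move=> [_ _] [/= -> ->]; exact: (nbhs_singleton Vbc).
Qed.

Lemma cvg_initial {S : choiceType} {T : topologicalType} (f : S -> T)
    (F : set_system S) (s : S) : Filter F ->
  f @ F --> f s -> F --> (s : initial_topology f).
Proof.
move=> FF fF V [_ /= [[B oB <-] Bfs] BV].
have nB : nbhs (f s) B by exact: open_nbhs_nbhs.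
exact: (@filterS _ F _ _ _ BV (fF B nB)).
Qed.

Lemma compact_set_typeP {X : topologicalType} (S : set X) :
  compact [set: set_type S] <-> compact S.
Proof.
split=> cS.
  rewrite (_ : S = set_val @` [set: set_type S]).
    apply: continuous_compact cS; apply: continuous_subspaceT.
    exact: (@initial_continuous (set_type S) X set_val).
  apply/seteqP; split=> [x Sx|_ [[x Sx] _ <-]]; last exact: set_mem Sx.
  by exists (exist _ x (mem_set Sx)).
rewrite compact_ultra => F FU _.
have [|p [Sp clp]] := cS (set_val @ F) _.
  by apply: (@filterE _ F) => -[x xS]; exact: set_mem xS.
exists (exist _ p (mem_set Sp)); split=> //; apply: cvg_initial.
exact: ultra_fmap_cluster.
Qed.

(** * Stone spaces and their continuous self-maps *)

Section StoneSpaces.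
Context {A : topologicalType} (hA : stone_space A).

Lemma stone_compact : compact [set: A]. Proof. by case: hA => -[]. Qed.

Lemma stone_compactX : compact [set: A * A].
Proof. by rewrite -setXTT; apply: compact_setX; exact: stone_compact. Qed.

Lemma stone_nbhs_clopen (x : A) (V : set A) : nbhs x V ->
  exists L : set A, [/\ clopen L, L x & L `<=` V].
Proof. by case: hA => _ [_ Ab] /Ab[L [Lc Lx] LV]; exists L. Qed.

Lemma stone_separated (x y : A) : x <> y ->
  exists L : set A, [/\ clopen L, L x & ~ L y].
Proof.
case: hA => -[cA hsA] _ xy.
have [clxy|] := pselect (cluster (nbhs x) y); first by case: xy; exact: hsA.
move=> /existsNP[U /existsNP[V /not_implyP[Ux /not_implyP[Vy UV]]]].
have [L [Lc Lx LU]] := stone_nbhs_clopen Ux.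
exists L; split=> // Ly; apply: UV; exists y; split; first exact: LU.
exact: nbhs_singleton.
Qed.

Lemma stone_regular : regular_space A.
Proof.
case: hA => -[cA hsA] _ x.
by apply: (compact_regular hsA cA); exact: filterT.
Qed.

Lemma stone_locally_compact : locally_compact [set: A].
Proof.
move=> x _; exists setT; first exact: filterT.
by split; [exact: stone_compact | exact: closedT].
Qed.

Lemma continuous_to_stone (f : A -> A) :
  (forall L : set A, clopen L -> forall x, L (f x) ->
     \forall y \near x, L (f y)) -> continuous f.
Proof.
move=> fL x V /stone_nbhs_clopen[L [Lc Lx LV]].
by apply: filterS (fL L Lc x Lx) => y /LV.
Qed.

Local Notation endo := (continuousType A A).

Lemma stone_eval_continuous : continuous (@eval A A).
Proof. exact: eval_continuous stone_locally_compact stone_regular. Qed.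

Lemma eval_cvg (f : endo) (a : A) :
  (p.1 : endo) p.2 @[p --> (f, a)] --> f a.
Proof.
rewrite (_ : (fun p => _) = @eval A A); last by apply/funext => -[].
exact: (@stone_eval_continuous (f, a)).
Qed.

Lemma eval_at_continuous (a : A) : continuous (fun f : endo => f a).
Proof.
move=> f.
apply: (@continuous_comp _ _ _ (fun g : endo => (g, a)) (@eval A A)).
  by apply: (@cvg_pair _ _ _ (nbhs f) (nbhs f) (nbhs a));
    [exact: cvg_id | exact: cvg_cst].
exact: (@stone_eval_continuous (f, a)).
Qed.

Lemma stone_comp_continuous :
  continuous (fun p : endo * endo => (p.1 \o p.2 : endo)).
Proof.
rewrite (_ : (fun p => _) = uncurry (comp : endo -> endo -> endo)).
  exact: compose_continuous stone_locally_compact stone_regular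
    stone_locally_compact stone_regular.
by apply/funext => -[].
Qed.

End StoneSpaces.

Definition agree {A : Type} (L : set A) : set (A * A) :=
  [set p | L p.1 <-> L p.2].

Lemma agree_clopen {A : topologicalType} (L : set A) :
  clopen L -> clopen (agree L).
Proof.
move=> Lc; apply: equivalence_clopen.
  by split=> [a|a b|a b c]; rewrite /agree /=; tauto.
by move=> x; apply: filterS (clopen_near x Lc) => y; rewrite /agree /=; tauto.
Qed.

Lemma stone_diagonal_agree {A : topologicalType} (p : A * A) :
  stone_space A -> (forall L, clopen L -> agree L p) -> p.1 = p.2.
Proof.
move=> hA pL; apply: contrapT => /(stone_separated hA)[L [Lc L1 L2]].
by have := pL L Lc; rewrite /agree /= => -[/(_ L1)].
Qed.

(** * Terms and translations *)

Section Terms.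
Context {Omega : nat -> topologicalType}.

Fixpoint rename {X Y : Type} (g : X -> Y) (t : term Omega X) : term Omega Y :=
  match t with
  | Var x => Var Omega (g x)
  | App n w ts => App w (fun i => rename g (ts i))
  end.

Lemma occurrences_rename (X Y : eqType) (g : X -> Y) (x : X) t :
  injective g -> occurrences (g x) (rename g t) = occurrences x t.
Proof.
move=> gI; elim: t => [y|n w ts IH] /=; first by rewrite inj_eq.
exact: eq_bigr.
Qed.

Context {A : topologicalType} (EA : topAlgebra Omega A).

Lemma eval_rename {X Y : Type} (g : X -> Y) (v : Y -> A) t :
  eval_term EA v (rename g t) = eval_term EA (v \o g) t.
Proof.
elim: t => [y|n w ts IH] //=; congr (eval_op EA w _).
by apply/funext => i; exact: IH.
Qed.

Lemma eval_term_absent {X : eqType} (x : X) (u v : X -> A) t :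
  occurrences x t = 0 -> (forall y, y != x -> u y = v y) ->
  eval_term EA u t = eval_term EA v t.
Proof.
move=> + uv; elim: t => [y|n w ts IH] /=.
  by case: eqVneq => // yx _; exact: uv.
move=> /eqP; rewrite sum_nat_eq0 => /forallP ts0.
congr (eval_op EA w _); apply/funext => i; apply: IH.
by have := ts0 i; move/eqP.
Qed.

Lemma congruence_term {R : set (A * A)} {X : Type} (u v : X -> A) t :
  congruence EA R -> (forall x, R (u x, v x)) ->
  R (eval_term EA u t, eval_term EA v t).
Proof.
move=> [_ _ _ Rop] uv; elim: t => [x|n w ts IH] /=; first exact: uv.
exact: Rop.
Qed.

Lemma eval_term_continuous {S : topologicalType} {X : Type} (v : S -> X -> A)
    t : (forall x, continuous (v ^~ x)) ->
  continuous (fun s => eval_term EA (v s) t).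
Proof.
move=> vc; elim: t => [x|n w ts IH] /=; first exact: vc.
pose g s : {ptws 'I_n -> A} := fun i => eval_term EA (v s) (ts i).
have gc : continuous g by apply: ptws_continuous => i; exact: IH.
move=> s; apply: (@continuous_comp _ _ _ (fun s' => (w, g s'))
  (fun p => eval_op EA p.1 p.2)); last exact: eval_op_continuous.
apply: (@cvg_pair _ _ _ (nbhs s) (nbhs w) (nbhs (g s))); last exact: gc.
exact: cvg_cst.
Qed.

(** One-hole contexts: the translations described without variables. Closure
    under composition and under the basic operations, awkward to state with
    linear terms, is immediate in this form. *)
Inductive context : (A -> A) -> Prop :=
  | context_id : context id
  | context_op n (w : Omega n) (c : 'I_n -> A) (i : 'I_n) f :
      context f ->
      context (fun x => eval_op EA w (fun j => if j == i then f x else c j)).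

Lemma context_ext_id f : f =1 id -> context f.
Proof. by move=> /funext->; exact: context_id. Qed.

Lemma context_comp f g : context f -> context g -> context (f \o g).
Proof.
by move=> cf cg; elim: cf => [|n w c i f' _ IH] //=; exact: context_op IH.
Qed.

(** Unless the term is the variable [x], exactly one argument of its root
    contains [x]; the others are constants, evaluated at an arbitrary point. *)
Lemma context_linear {X : eqType} (t : term Omega X) (x : X) (v : A -> X -> A) :
  linear_in x t -> (forall a, v a x = a) ->
  (forall a b y, y != x -> v a y = v b y) ->
  context (fun a => eval_term EA (v a) t).
Proof.
move=> + vx vN; rewrite /linear_in.
(* On an empty algebra every self-map is the identity. *)
have [[a0 _]|nA] := pselect (exists a : A, True); last first.
  by move=> _; apply: context_ext_id => a; case: nA; exists a.
elim: t => [y|n w ts IH] /=.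
  by case: eqVneq => // -> _; apply: context_ext_id => a; exact: vx.
move=> sum1.
have [i occ1] : exists i, occurrences x (ts i) <> 0.
  apply: contrapT => nts; move: sum1; rewrite big1 // => i _.
  by apply: contrapT => ?; apply: nts; exists i.
move: sum1; rewrite (bigD1 i) //=.
case occ_i: (occurrences x (ts i)) occ1 => [|[|k]] // _.
rewrite add1n => /eqP; rewrite eqSS sum_nat_eq0 => /forallP occ0.
rewrite (_ : (fun _ => _) = fun a => eval_op EA w (fun j =>
  if j == i then eval_term EA (v a) (ts i) else eval_term EA (v a0) (ts j))).
  by apply: context_op; exact: IH.
apply/funext => a; congr (eval_op EA w _); apply/funext => j.
case: eqVneq => [->//|ji]; apply: eval_term_absent (vN a a0).
by apply/eqP; have := occ0 j; rewrite ji.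
Qed.

(** The variables of a context with one more operation are those of the inner
    context together with one variable for each argument of the operation. *)
Lemma context_term f : context f -> forall a0 : A,
  exists m (t : term Omega 'I_m) (i : 'I_m) (a : 'I_m -> A),
    linear_in i t /\
    f = fun x => eval_term EA (fun j => if j == i then x else a j) t.
Proof.
move=> + a0; elim=> [|n w c k g _ [m [t [i [a [ti ->]]]]]].
  exists 1, (Var Omega ord0), ord0, (fun=> a0); split; last exact/funext.
  by [].
exists (m + n).
exists (App w (fun j => if j == k then rename (lshift n) t
                        else Var Omega (rshift m j))).
exists (lshift n i).
exists (fun j : 'I_(m + n) =>
  match fintype.split j with inl j' => a j' | inr j' => c j' end); split.
  rewrite /linear_in /= (bigD1 k) //= eqxx.
  rewrite (occurrences_rename _ _ (@lshift_inj _ _)) ti big1 // => j /negPf->.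
  by rewrite /= eq_rlshift.
apply/funext => x /=; congr (eval_op EA w _); apply/funext => j.
case: eqVneq => _ /=; last by rewrite eq_rlshift (unsplitK (inr j)).
rewrite eval_rename; congr (eval_term EA _ t); apply/funext => l /=.
by rewrite (inj_eq (@lshift_inj _ _)) (unsplitK (inl l)).
Qed.

Lemma subst_at_self m (i : 'I_m) (a : {j : 'I_m | j != i} -> A) x :
  subst_at a x i = x.
Proof. by rewrite /subst_at insubF // eqxx. Qed.

Lemma subst_at_other m (i : 'I_m) (a : {j : 'I_m | j != i} -> A) x y j :
  j != i -> subst_at a x j = subst_at a y j.
Proof. by move=> ji; rewrite /subst_at (insubT (fun j => j != i) ji). Qed.

Lemma translations_context : translations EA = context.
Proof.
apply/seteqP; split=> f.
  move=> [m [t [i [a [ti ->]]]]].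
  apply: (context_linear ti) => *; first exact: subst_at_self.
  exact: subst_at_other.
have [[a0 _]|nA] := pselect (exists a : A, True).
  move=> /context_term/(_ a0)[m [t [i [a [ti ->]]]]].
  exists m, t, i, (fun j => a (val j)); split=> //; apply/funext => x.
  congr (eval_term EA _ t); apply/funext => j; case: eqVneq => [->|ji].
    by rewrite subst_at_self.
  by rewrite /subst_at (insubT (fun j => j != i) ji).
move=> _; have noA (a : A) : False by apply: nA; exists a.
exists 1, (Var Omega ord0), ord0.
have no_other (j : {j : 'I_1 | j != ord0}) : False.
  by case: j => j; rewrite (ord1 j) eqxx.
exists (fun j => False_rect A (no_other j)); split; last first.
  by apply/funext => x; case: (noA x).
by [].
Qed.

Lemma translations_id : translations EA id.
Proof. by rewrite translations_context; exact: context_id. Qed.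

Lemma translations_comp f g : translations EA f -> translations EA g ->
  translations EA (f \o g).
Proof. by rewrite translations_context; exact: context_comp. Qed.

Lemma translations_op n (w : Omega n) (c : 'I_n -> A) (i : 'I_n) :
  translations EA (fun x => eval_op EA w (fun j => if j == i then x else c j)).
Proof. by rewrite translations_context; exact: context_op context_id. Qed.

Lemma translations_continuous f : translations EA f -> continuous f.
Proof.
move=> [m [t [i [a [_ ->]]]]]; apply: eval_term_continuous => j.
rewrite /subst_at; case: (insub j) => [k|] /=; first exact: cst_continuous.
by move=> x; exact: cvg_id.
Qed.

Lemma congruence_translation {R : set (A * A)} f a b :
  congruence EA R -> translations EA f -> R (a, b) -> R (f a, f b).
Proof.
move=> Rc [m [t [i [c [_ ->]]]]] Rab; apply: congruence_term => // j.
by rewrite /subst_at; case: (insub j) => [k|] //=; case: Rc.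
Qed.

Lemma syntactic_translation L f a b : translations EA f ->
  syntactic EA L (a, b) -> syntactic EA L (f a, f b).
Proof.
by move=> Mf Lab g Mg; exact: (Lab _ (translations_comp Mg Mf)).
Qed.

(** The arguments [a] of an operation are replaced by [b] one at a time; each
    replacement happens inside a translation. *)
Lemma syntactic_congruence L : congruence EA (syntactic EA L).
Proof.
split=> [a f _ //|a b ab f Mf|a b c ab bc f Mf|n w a b ab].
- by have := ab f Mf; tauto.
- by have := ab f Mf; have := bc f Mf; rewrite /=; tauto.
pose c k : 'I_n -> A := fun j => if j < k then b j else a j.
have cS k : k < n -> syntactic EA L (eval_op EA w (c k), eval_op EA w (c k.+1)).
  move=> kn; pose i := Ordinal kn.
  have := syntactic_translation (translations_op w (c k) i) (ab i).
  congr (syntactic EA L (eval_op EA w _, eval_op EA w _)); apply/funext => j;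
    rewrite /c; case: eqVneq => [->|ji] /=; rewrite ?ltnn ?ltnSn //.
  suff -> : (j < k.+1) = (j < k) by [].
  by move: ji; rewrite -val_eqE /=; lia.
have c0n k : k <= n -> syntactic EA L (eval_op EA w a, eval_op EA w (c k)).
  elim: k => [_|k IH kn f Mf]; first by move=> f _.
  by rewrite (IH (ltnW kn) f Mf); exact: cS.
suff <- : c n = b by exact: c0n.
by apply/funext => j; rewrite /c ltn_ord.
Qed.

Lemma syntactic_agree L a b : syntactic EA L (a, b) -> (L a <-> L b).
Proof. exact (fun h => h id translations_id). Qed.

Lemma syntactic_preimage L f a b : translations EA f ->
  syntactic EA L (a, b) -> syntactic EA (f @^-1` L) (a, b).
Proof. by move=> Mf Lab g Mg; exact: (Lab _ (translations_comp Mf Mg)). Qed.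

(** Finitely many translations must be written with the same variables; dummy
    variables make this possible, and they all get the value [a0]. *)
Lemma translations_subst_first f : translations EA f ->
  \forall n \near \oo, exists t : term Omega 'I_n.+1, forall a0 : A,
    exists b : 'I_n -> A, f = fun x => eval_term EA (subst_first x b) t.
Proof.
move=> [m [t [i [a [_ ->]]]]]; exists m => // n /= mn.
pose g (j : 'I_m) : 'I_n.+1 :=
  if j == i then ord0 else lift ord0 (widen_ord mn j).
exists (rename g t) => a0.
exists (fun k => if insub (val k) is Some j then subst_at a a0 j else a0).
apply/funext => x; rewrite eval_rename; congr (eval_term EA _ t).
apply/funext => j; rewrite /subst_first /g /=; case: eqVneq => [->|ji].
  by rewrite unlift_none subst_at_self.
rewrite liftK /= valK; exact: subst_at_other.
Qed.

Lemma eval_subst_first_continuous m (t : term Omega 'I_m.+1) :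
  continuous (fun p : {ptws 'I_m -> A} * A =>
    eval_term EA (subst_first p.2 p.1) t).
Proof.
apply: eval_term_continuous => j; rewrite /subst_first.
case: (unlift ord0 j) => [i|] /= p; last exact: cvg_snd.
apply: (@continuous_comp _ _ _ fst (fun b : {ptws 'I_m -> A} => b i)).
  exact: cvg_fst.
exact: (@proj_continuous _ (fun=> A) i).
Qed.

End Terms.

(** * Clopen syntactic congruences *)

Section Profinite.
Context {Omega : nat -> topologicalType} {A : topologicalType}.
Context (EA : topAlgebra Omega A) (hA : stone_space A).

Local Notation endo := (continuousType A A).
Let cA : compact [set: A] := stone_compact hA.
Let cAA : compact [set: A * A] := stone_compactX hA.

Lemma congruence_equivalence (R : set (A * A)) :
  congruence EA R -> equivalence R.
Proof. by case. Qed.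

Lemma syntactic_clopen_near (L : set A) :
  clopen (syntactic EA L) <->
  forall x, \forall y \near x, syntactic EA L (x, y).
Proof.
split; last first.
  exact/equivalence_clopen/congruence_equivalence/syntactic_congruence.
move=> [oR _] x.
have : nbhs (x, x) (syntactic EA L) by apply: open_nbhs_nbhs; split.
case=> -[P Q] [/= xP xQ] PQ; apply: filterS xQ => y Qy.
by apply: (PQ (x, y)); split => //=; exact: nbhs_singleton.
Qed.

Lemma preimage_translation_clopen (L : set A) f :
  translations EA f -> clopen L -> clopen (f @^-1` L).
Proof.
move=> Mf Lc; apply: preimage_clopen => //.
exact: translations_continuous Mf.
Qed.

Definition clopen_syntactic : Prop :=
  forall L : set A, clopen L -> clopen (syntactic EA L).

(** * Conditions that make the syntactic congruences clopen *)

(** The congruences with open classes separate points, so finitely many of them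
    suffice for the agreement relation of [L]. *)
Lemma syntactic_clopen_of_residually_finite (L : set A) :
  residually_finite_alg EA -> clopen L -> clopen (syntactic EA L).
Proof.
move=> rf Lc; apply/syntactic_clopen_near => x.
pose D := [set R : set (A * A) |
  congruence EA R /\ forall x, \forall y \near x, R (x, y)].
have [R [Rc Rn]||E [fE ED EL]] :=
  @compact_finite_bigcap _ _ D id (agree L) cAA _ (agree_clopen Lc).1.
- exact: (equivalence_clopen (congruence_equivalence Rc) Rn).2.
- move=> [a b] Dab; suff -> : a = b by [].
  apply: contrapT => /rf[B [EB [phi [_ phic phiM ab]]]]; apply: ab.
  apply: (Dab [set p | phi p.1 = phi p.2]); split.
    split=> //= [u v w -> //|n w u v uv].
    by rewrite !phiM; congr (eval_op EB w _); apply/funext.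
  move=> u; have nu := phic u _ (discrete_set1 (phi u)).
  by apply: (@filterS _ (nbhs u) _ _ _ _ nu) => v /= ->.
- have : \forall y \near x, forall R, E R -> R (x, y).
    by apply: near_finite_forall => // R /ED[_]; apply.
  apply: filterS => y Exy f Mf; apply: (EL (f x, f y)) => R ER.
  by apply: congruence_translation Mf _; [case: (ED R ER) | exact: Exy].
Qed.

Lemma clopen_syntactic_of_equicontinuous :
  equicontinuous_on (translations EA) -> clopen_syntactic.
Proof.
move=> eqc L Lc; apply/syntactic_clopen_near => x.
have [|U [oU Ux UL]] := eqc (agree L) _ x.
  exists (agree L); first by case: (agree_clopen Lc).
  by split=> // -[a b]; rewrite /diagonal /agree /= => ->.
have : nbhs x U by exact: open_nbhs_nbhs.
apply: filterS => y Uy f Mf.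
by apply: (UL f Mf (f x, f y)); split; [exists x | exists y].
Qed.

Lemma syntactic_clopen_of_compact_determined (L : set A) (C : set endo) :
  clopen L -> compact C -> determined_by EA L [set (f : A -> A) | f in C] ->
  clopen (syntactic EA L).
Proof.
move=> Lc cC LC; apply/syntactic_clopen_near => x.
have := near_compact_agree (h := fun f : endo => f : A -> A) cC Lc
  (fun f _ => @eval_cvg _ hA f x).
by apply: filterS => y Cxy; apply/LC => _ [f Cf <-]; exact: Cxy.
Qed.

Lemma syntactic_clopen_of_finite_terms (L : set A) :
  clopen L -> determined_by_finite_terms EA L -> clopen (syntactic EA L).
Proof.
move=> Lc [m [F [fF LF]]]; apply/syntactic_clopen_near => x.
have cAm : compact [set: {ptws 'I_m -> A}].
  rewrite (_ : setT = [set f : 'I_m -> A | forall i, [set: A] (f i)]).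
    exact: (@tychonoff 'I_m (fun=> A) (fun=> setT) (fun=> cA)).
  by apply/seteqP; split.
have : \forall y \near x, forall t, F t ->
    forall b : {ptws 'I_m -> A}, [set: {ptws 'I_m -> A}] b ->
    (L (eval_term EA (subst_first x b) t) <->
     L (eval_term EA (subst_first y b) t)).
  apply: near_finite_forall => // t _.
  apply: (near_compact_agree
    (h := fun (b : {ptws 'I_m -> A}) a => eval_term EA (subst_first a b) t)
    cAm Lc) => b _.
  exact: (@eval_subst_first_continuous _ _ EA m t (b, x)).
by apply: filterS => y Fxy; apply/LF => t Ft b; exact: Fxy.
Qed.

(** * Finite quotients, finite determination and equicontinuity *)

Lemma finite_quotient_of_clopen_syntactic (L : set A) :
  clopen (syntactic EA L) ->
  exists (B : discreteTopologicalType) (EB : topAlgebra Omega B)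
         (phi : A -> B),
    [/\ finite_set [set: B], continuous phi, alg_hom EA EB phi,
        range phi = [set: B] & L = phi @^-1` (phi @` L)].
Proof.
move=> /syntactic_clopen_near sn; have sC := syntactic_congruence EA L.
have [B [pi [r [fB pic rK piP]]]] :=
  finite_discrete_quotient cA (congruence_equivalence sC) sn.
pose opB n (w : Omega n) (b : 'I_n -> B) := pi (eval_op EA w (r \o b)).
have opBc n :
    continuous (fun p : Omega n * {ptws 'I_n -> B} => opB n p.1 p.2).
  have rc : continuous
      (fun b : {ptws 'I_n -> B} => (r \o b : {ptws 'I_n -> A})).
    apply: ptws_continuous => i b.
    apply: (@continuous_comp _ _ _ (fun b : {ptws 'I_n -> B} => b i) r).
      exact: (@proj_continuous _ (fun=> B) i).
    exact: discrete_continuous.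
  have rc2 : continuous (fun p : Omega n * {ptws 'I_n -> B} =>
      (p.1, r \o p.2 : {ptws 'I_n -> A})).
    move=> [w b]; apply: (@cvg_pair _ _ _ (nbhs (w, b)) (nbhs w)
      (nbhs (r \o b : {ptws 'I_n -> A}))); first exact: cvg_fst.
    exact: (@cvg_comp _ _ _ snd _ (nbhs (w, b)) (nbhs b) _ cvg_snd (rc b)).
  move=> p; pose ev (q : Omega n * {ptws 'I_n -> A}) := eval_op EA q.1 q.2.
  have evc : continuous ev by exact: eval_op_continuous.
  exact: (continuous_comp (rc2 p) (continuous_comp (evc _) (pic _))).
exists B, (TopAlgebra opBc), pi; split=> //.
- move=> n w a /=; apply/piP; case: sC => _ _ _; apply => i.
  by apply/piP; rewrite /= rK.
- by apply/seteqP; split=> // b _; exists (r b) => //; exact: rK.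
- apply/seteqP; split=> [a La|a [b Lb /piP ba]]; first by exists a.
  exact/(syntactic_agree ba).
Qed.

Lemma profinite_of_finite_quotients :
  (forall L : set A, clopen L ->
     exists (B : discreteTopologicalType) (EB : topAlgebra Omega B)
            (phi : A -> B),
       [/\ finite_set [set: B], continuous phi, alg_hom EA EB phi,
           range phi = [set: B] & L = phi @^-1` (phi @` L)]) ->
  profinite_alg EA.
Proof.
move=> fq; split; first by case: hA.
move=> a a' /(stone_separated hA)[L [Lc La La']].
have [B [EB [phi [fB phic phiM _ LE]]]] := fq L Lc.
exists B, EB, phi; split=> // aa'; apply: La'.
by rewrite LE /=; exists a.
Qed.

Lemma finite_determined_of_clopen_syntactic (L : set A) :
  clopen L -> clopen (syntactic EA L) ->
  exists F : set (A -> A),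
    [/\ finite_set F, F `<=` translations EA & determined_by EA L F].
Proof.
move=> Lc [oS _].
have [f Mf||F [fF FM FL]] := @compact_finite_bigcap _ _ (translations EA)
  (fun f => agree (f @^-1` L)) (syntactic EA L) cAA _ oS.
- by case: (agree_clopen (preimage_translation_clopen Mf Lc)).
- by move=> p pM f Mf; exact: (pM f Mf).
- exists F; split=> // a b; split=> [Lab f Ff|Fab].
    exact: (Lab f (FM f Ff)).
  by apply: FL => f Ff; exact: Fab.
Qed.

Lemma finite_continuous_determined (L : set A) (F : set (A -> A)) :
  finite_set F -> F `<=` translations EA -> determined_by EA L F ->
  exists G : set endo,
    finite_set G /\ determined_by EA L [set (f : A -> A) | f in G].
Proof.
move=> fF FM LF; exists [set f : endo | F f]; split.
  apply: (@finite_preimage _ _ F (fun f : endo => f : A -> A)) => //.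
  by move=> f g _ _ fg; apply/continuousEP => x; rewrite fg.
move=> a b; rewrite LF; split=> [Fab _ [f Ff <-]|Fab f Ff]; first exact: Fab.
by apply: Fab; exists (mkcts (translations_continuous (FM f Ff))).
Qed.

(** The terms of the translations in [F] are not weaker than [F], since the
    parameters of these translations are among the values of the other
    variables, and not stronger than [sigma_L], since [sigma_L] is a
    congruence. *)
Lemma finite_terms_of_finite_determined (L : set A) (F : set (A -> A)) :
  finite_set F -> F `<=` translations EA -> determined_by EA L F ->
  determined_by_finite_terms EA L.
Proof.
move=> fF FM LF.
pose represents N f (t : term Omega 'I_N.+1) := forall a0 : A,
  exists b : 'I_N -> A, f = fun x => eval_term EA (subst_first x b) t.
have [N FN] : exists N, forall f, F f -> exists t, represents N f t.
  have : \forall N \near \oo, forall f, F f -> exists t, represents N f t.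
    by apply: near_finite_forall => // f /FM; exact: translations_subst_first.
  exact: filter_ex.
have /choice[T TP] : forall f, exists t, F f -> represents N f t.
  move=> f; have [/FN[t tP]|nF] := pselect (F f); first by exists t.
  by exists (Var Omega ord0).
exists N, (T @` F); split; first exact: finite_image.
move=> a b; split=> [Lab _ [f _ <-] c|Tab].
  apply: (syntactic_agree (EA := EA)).
  apply: (congruence_term _ (syntactic_congruence EA L)).
  by move=> j; rewrite /subst_first; case: (unlift ord0 j).
apply/LF => f Ff; have [c fE] := TP f Ff a.
by rewrite fE; apply: Tab; exists f.
Qed.

(** Every entourage contains the agreement relation of finitely many clopen
    sets, and their syntactic congruences provide a neighborhood of [x] on
    which all translations vary less than the entourage. *)
Lemma equicontinuous_of_clopen_syntactic :
  clopen_syntactic -> equicontinuous_on (translations EA).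
Proof.
move=> hs alpha [V oV [diagV Valpha]] x.
have [L Lc||E [fE ED EV]] :=
  @compact_finite_bigcap _ _ clopen agree V cAA _ oV.
- by case: (agree_clopen Lc).
- move=> p pL; apply: diagV; rewrite /diagonal /=.
  exact: stone_diagonal_agree hA pL.
have : nbhs x [set y | forall L, E L -> syntactic EA L (x, y)].
  by apply: near_finite_forall => // L /ED/hs/syntactic_clopen_near; apply.
rewrite nbhsE => -[U [oU Ux] US]; exists U; split=> // f Mf.
move=> [_ _] [/= [y Uy <-] [z Uz <-]]; apply/Valpha/EV => L EL.
rewrite /agree /= -(US y Uy L EL f Mf); exact: (US z Uz L EL f Mf).
Qed.

(** * Compactness of the translation monoid *)

(** The condition, closed under pointwise limits, that stands for
    equicontinuity once the syntactic congruences are clopen. *)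
Definition syntactic_compatible : set endo :=
  [set f | forall L, clopen L -> forall a b,
     syntactic EA L (a, b) -> L (f a) <-> L (f b)].

Lemma ctranslations_compatible : ctranslations EA `<=` syntactic_compatible.
Proof. by move=> f Mf L _ a b; apply. Qed.

Lemma closure_ctranslations_compatible :
  closure (ctranslations EA) `<=` syntactic_compatible.
Proof.
move=> f clf L Lc a b Lab.
have near_f c : nbhs f [set g : endo | L (g c) <-> L (f c)].
  exact: (eval_at_continuous hA (clopen_near (f c) Lc)).
have [g [Mg [/= gaf gbf]]] := clf _ (filterI (near_f a) (near_f b)).
by have := Lab g Mg; rewrite /=; tauto.
Qed.

Lemma closure_ctranslations_syntactic f (L : set A) a b :
  closure (ctranslations EA) f -> clopen L ->
  syntactic EA L (a, b) -> syntactic EA L (f a, f b).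
Proof.
move=> clf Lc Lab g Mg.
apply: (closure_ctranslations_compatible clf
  (preimage_translation_clopen Mg Lc)).
exact: syntactic_preimage.
Qed.

(** An ultrafilter of compatible maps has a pointwise limit [g], which is again
    compatible. On the [sigma_L]-class of a point [a] with [g a] in [L], an open
    set, the maps close to [g] at [a] take values in [L]; hence [g] is
    continuous and the convergence is uniform enough for the compact-open
    topology. *)
Lemma syntactic_compatible_compact :
  clopen_syntactic -> compact syntactic_compatible.
Proof.
move=> hs; rewrite compact_ultra => F FU FK.
have /choice[g Fg] : forall a, exists y : A, (fun f : endo => f a) @ F --> y.
  by move=> a; exact: cvg_compact_ultra.
have gF L : clopen L -> forall a, L (g a) -> F [set f : endo | L (f a)].
  by move=> [oL _] a La; apply: (Fg a L); exact: open_nbhs_nbhs.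
have gL L : clopen L ->
    forall a b, syntactic EA L (a, b) -> L (g a) -> L (g b).
  move=> Lc a b Lab La; apply: contrapT => nLb.
  have Fa := gF L Lc a La; have Fb := gF _ (clopenC L Lc) b nLb.
  have [f [[fK fa] fb]] := filter_ex (filterI (filterI FK Fa) Fb).
  exact/fb/(fK L Lc a b Lab).
have gc : continuous g.
  apply: (continuous_to_stone hA) => L Lc x Lx.
  have /syntactic_clopen_near/(_ x) := hs L Lc.
  by apply: filterS => y /gL; apply.
pose gC : endo := mkcts gc.
exists gC; split.
  move=> L Lc a b Lab; split; first exact: gL.
  by apply: gL => // f /Lab[].
apply: cvg_initial; apply/compact_open_cvgP => K O cK oO gKO.
have : F [set f : endo | K `<=` [set a | O (f a)]].
  apply: (iffLR (compact_near_coveringP K) cK) => a Ka.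
  have nO : nbhs (g a) O.
    by apply: open_nbhs_nbhs; split=> //; apply: gKO; exists a.
  have [L [Lc La LO]] := stone_nbhs_clopen hA nO.
  have /syntactic_clopen_near/(_ a) na := hs L Lc.
  exists ([set a' | syntactic EA L (a, a')],
          [set f : endo | syntactic_compatible f /\ L (f a)]).
    by split=> //; apply: filterI => //; exact: gF.
  by move=> [a' f] [/= aa' [fK Lfa]]; apply: LO; exact/(fK L Lc a a' aa').
by apply: (@filterS _ F) => f fK _ [a Ka <-]; exact: fK.
Qed.

Lemma compact_determined_of_relatively_compact (L : set A) :
  relatively_compact (ctranslations EA) -> clopen L ->
  exists C : set endo,
    compact C /\ determined_by EA L [set (f : A -> A) | f in C].
Proof.
move=> [K cK MK] Lc; exists (K `&` closure (ctranslations EA)); split.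
  by apply: compact_closedI => //; exact: closed_closure.
move=> a b; split=> [Lab _ [f [_ clf] <-]|Cab f Mf].
  exact: closure_ctranslations_compatible clf _ Lc _ _ Lab.
have fc := translations_continuous Mf.
have Mfc : ctranslations EA (mkcts fc : endo) by [].
apply: Cab; exists (mkcts fc) => //.
by split; [exact: MK | exact: subset_closure].
Qed.

Lemma relatively_compact_of_profinite_submonoid :
  profinite_submonoid (closure (ctranslations EA)) ->
  relatively_compact (ctranslations EA).
Proof.
move=> [MS [_ _ [[cS _] _]]]; exists (closure (ctranslations EA)).
  exact/compact_set_typeP.
exact: subset_closure.
Qed.

(** * The closure of the translation monoid *)

Lemma closure_ctranslations_id : closure (ctranslations EA) (idfun : endo).
Proof. by apply: subset_closure; exact: translations_id. Qed.

Lemma closure_ctranslations_comp (f g : endo) :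
  closure (ctranslations EA) f -> closure (ctranslations EA) g ->
  closure (ctranslations EA) (f \o g : endo).
Proof.
move=> Mf Mg V Vfg.
have [[P Q] [/= fP gQ] PQ] := @stone_comp_continuous _ hA (f, g) V Vfg.
have [f' [Mf' Pf']] := Mf P fP; have [g' [Mg' Qg']] := Mg Q gQ.
exists (f' \o g' : endo); split; last exact: (PQ (f', g')).
exact: (translations_comp Mf' Mg').
Qed.

Let N := set_type (closure (ctranslations EA)).

Let nmul (f g : N) : N := exist _ (set_val f \o set_val g : endo)
  (mem_set
    (closure_ctranslations_comp (set_mem (valP f)) (set_mem (valP g)))).

Let nid : N := exist _ (idfun : endo) (mem_set closure_ctranslations_id).

Let nval_continuous : continuous (set_val : N -> endo).
Proof. exact: (@initial_continuous N _ set_val). Qed.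

Lemma closed_submonoid_ext (f g : N) :
  (forall x, set_val f x = set_val g x) -> f = g.
Proof. by move=> fg; apply: val_inj; apply/continuousEP. Qed.

Lemma closed_submonoid_eval_continuous (a : A) :
  continuous (fun f : N => set_val f a).
Proof.
move=> f; apply: (@continuous_comp N endo A set_val (fun f => f a)).
  exact: nval_continuous.
exact: eval_at_continuous.
Qed.

Lemma closed_submonoid_mul_continuous :
  continuous (fun p : N * N => nmul p.1 p.2).
Proof.
apply: continuous_comp_initial => p.
pose v2 (q : N * N) : endo * endo := (set_val q.1, set_val q.2).
have v2c : continuous v2.
  move=> [f g]; apply: (@cvg_pair _ _ _ (nbhs (f, g))
    (nbhs (set_val f)) (nbhs (set_val g))).
    exact: (@cvg_comp _ _ _ fst _ (nbhs (f, g)) (nbhs f) _ cvg_fst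
      (@nval_continuous f)).
  exact: (@cvg_comp _ _ _ snd _ (nbhs (f, g)) (nbhs g) _ cvg_snd
    (@nval_continuous g)).
exact: (continuous_comp (v2c p) (@stone_comp_continuous _ hA (v2 p))).
Qed.

Lemma closed_submonoid_hausdorff : hausdorff_space N.
Proof.
move=> f g fg; apply: closed_submonoid_ext => a; apply: contrapT.
move=> /(stone_separated hA)[L [Lc Lf Lg]].
have [h [/= hf hg]] := fg _ _
  (@closed_submonoid_eval_continuous a f _ (clopen_near _ Lc))
  (@closed_submonoid_eval_continuous a g _ (clopen_near _ Lc)).
by apply: Lg; apply/hg/hf.
Qed.

(** If [f] and [g] differ at [a] and [L] separates [f a] from [g a], then [f]
    and [g] act differently on the finite set [A / sigma_L]. The homomorphism
    that separates them is the quotient of the monoid by the relation of acting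
    equally on [A / sigma_L]. *)
Lemma profinite_submonoid_of_clopen_syntactic :
  clopen_syntactic -> profinite_submonoid (closure (ctranslations EA)).
Proof.
move=> hs.
have cM : compact (closure (ctranslations EA)).
  have := compact_closedI (syntactic_compatible_compact hs)
    (@closed_closure _ (ctranslations EA)).
  by rewrite (setIidr closure_ctranslations_compatible).
have cN : compact [set: N] by exact/compact_set_typeP.
have mA : associative nmul by move=> f g h; exact: closed_submonoid_ext.
have m1m : left_id nid nmul by move=> f; exact: closed_submonoid_ext.
have mm1 : right_id nid nmul by move=> f; exact: closed_submonoid_ext.
exists (TopMonoid mA m1m mm1 closed_submonoid_mul_continuous); split=> //.
split; first by split=> //; exact: closed_submonoid_hausdorff.
move=> f g fg.
have [a fga] : exists a, set_val f a <> set_val g a.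
  apply: contrapT => nfg; apply: fg; apply: closed_submonoid_ext => x.
  by apply: contrapT => fgx; apply: nfg; exists x.
have [L [Lc Lf Lg]] := stone_separated hA fga.
have [Sr Ss St _] := syntactic_congruence EA L.
pose ev (u : N) (x : A) : A := (set_val u : endo) x.
pose R : set (N * N) :=
  [set p | forall x, syntactic EA L (ev p.1 x, ev p.2 x)].
have Req : equivalence R.
  split=> [u x|u v uv x|u v w uv vw x]; first exact: Sr.
    exact: Ss (uv x).
  exact: St (uv x) (vw x).
have Rn (u : N) : \forall v \near u, R (u, v).
  suff : \forall v \near u,
      [set: A] `<=` [set x | syntactic EA L (ev u x, ev v x)].
    by apply: (@filterS _ (nbhs u)) => v uv x; exact: uv.
  apply: (iffLR (compact_near_coveringP _) cA N (nbhs u)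
    (fun v x => syntactic EA L (ev u x, ev v x))) => x _.
  have nx := (iffLR (syntactic_clopen_near L) (hs L Lc)) (ev u x).
  have [[P Q] [/= uP xQ] PQ] := @eval_cvg _ hA (set_val u) x _ nx.
  exists (Q, set_val @^-1` P).
    by split=> //; exact: (@nval_continuous u P uP).
  move=> [x' v] [/= Qx' Pv]; apply: (St _ (ev u x)).
    apply: Ss; apply: (PQ (set_val u, x')).
    by split=> //; exact: nbhs_singleton uP.
  exact: (PQ (set_val v, x')).
have Rmul u u' v v' : R (u, u') -> R (v, v') -> R (nmul u v, nmul u' v').
  move=> uu' vv' x; apply: St (uu' _) _.
  apply: closure_ctranslations_syntactic => //; last exact: vv'.
  exact: set_mem (valP u').
have [B [pi [r [fB pic rK piP]]]] := finite_discrete_quotient cN Req Rn.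
pose bmul b c := pi (nmul (r b) (r c)).
have piM u v : pi (nmul u v) = bmul (pi u) (pi v).
  by apply/piP/Rmul; apply/piP; rewrite rK.
have bA : associative bmul.
  by move=> b c d; rewrite -(rK b) -(rK c) -(rK d) -!piM mA.
have b1m : left_id (pi nid) bmul by move=> b; rewrite -(rK b) -piM m1m.
have bm1 : right_id (pi nid) bmul by move=> b; rewrite -(rK b) -piM mm1.
have bc : continuous (fun p : B * B => bmul p.1 p.2).
  exact: discrete_pair_continuous.
exists B, (TopMonoid bA b1m bm1 bc), pi.
split; [exact: fB | exact: pic | by split=> //; exact: piM |].
by move=> /piP fgR; apply: Lg; apply/(syntactic_agree (fgR a)).
Qed.

End Profinite.

(** * The equivalences *)

Theorem theorem6p1 (Omega : nat -> topologicalType) (A : topologicalType)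
    (EA : topAlgebra Omega A) (hA : stone_space A) :
  [<-> profinite_alg EA;
       forall L : set A, clopen L ->
         congruence EA (syntactic EA L) /\ clopen (syntactic EA L);
       equicontinuous_on (translations EA);
       relatively_compact (ctranslations EA);
       profinite_submonoid (closure (ctranslations EA));
       forall L : set A, clopen L ->
         exists (B : discreteTopologicalType) (EB : topAlgebra Omega B)
                (phi : A -> B),
           [/\ finite_set [set: B], continuous phi, alg_hom EA EB phi,
               range phi = [set: B] & L = phi @^-1` (phi @` L)];
       forall L : set A, clopen L -> determined_by_finite_terms EA L;
       forall L : set A, clopen L ->
         exists F : set (A -> A),
           [/\ finite_set F, F `<=` translations EA & determined_by EA L F];
       forall L : set A, clopen L ->
         exists F : set (continuousType A A),
           finite_set F /\
           determined_by EA L [set (f : A -> A) | f in F];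
       forall L : set A, clopen L ->
         exists C : set (continuousType A A),
           compact C /\
           determined_by EA L [set (f : A -> A) | f in C]].
Proof.
have of_compact_determined : (forall L : set A, clopen L ->
    exists C : set (continuousType A A),
      compact C /\ determined_by EA L [set (f : A -> A) | f in C]) ->
    clopen_syntactic EA.
  move=> h L Lc; have [C [cC LC]] := h L Lc.
  exact: syntactic_clopen_of_compact_determined LC.
have of_relatively_compact :
    relatively_compact (ctranslations EA) -> clopen_syntactic EA.
  move=> rc; apply: of_compact_determined => L.
  exact: compact_determined_of_relatively_compact.
have to_profinite : clopen_syntactic EA -> profinite_alg EA.
  move=> hs; apply: profinite_of_finite_quotients => // L /hs.
  exact: finite_quotient_of_clopen_syntactic.
tfae.
- move=> [_ rf] L Lc; split; first exact: syntactic_congruence.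
  exact: syntactic_clopen_of_residually_finite.
- by move=> h; apply: equicontinuous_of_clopen_syntactic => // L /h[].
- move=> /clopen_syntactic_of_equicontinuous hs.
  exists (syntactic_compatible EA); first exact: syntactic_compatible_compact.
  exact: ctranslations_compatible.
- move=> /of_relatively_compact.
  exact: profinite_submonoid_of_clopen_syntactic.
- move=> /relatively_compact_of_profinite_submonoid/of_relatively_compact.
  by move=> hs L /hs; exact: finite_quotient_of_clopen_syntactic.
- move=> fq L Lc; have [_ rf] := profinite_of_finite_quotients hA fq.
  have sc := syntactic_clopen_of_residually_finite hA rf Lc.
  have [F [fF FM LF]] := finite_determined_of_clopen_syntactic hA Lc sc.
  exact: finite_terms_of_finite_determined LF.
- move=> ft L Lc; apply: finite_determined_of_clopen_syntactic => //.
  by apply: syntactic_clopen_of_finite_terms => //; exact: ft.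
- move=> fd L Lc; have [F [fF FM LF]] := fd L Lc.
  exact: finite_continuous_determined LF.
- move=> fd L Lc; have [F [fF LF]] := fd L Lc.
  by exists F; split=> //; exact: finite_compact.
- by move=> /of_compact_determined/to_profinite.
Qed.
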